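(* Let $n\ge 2$ and $1\le i\ne j\le\binom n2$. Suppose that there are integers $a,b$ with $|i-j|\le a\le b\le\min\{i+j,\binom n2\}$ such that $\mathscr{Y}_{n,i}\mathscr{Y}_{n,j}$ is a $\mathbb{Z}[q]$-linear combination of $\mathscr{Y}_{n,a},\mathscr{Y}_{n,a+1},\dots,\mathscr{Y}_{n,b}$. Then $\mathscr{Y}_{n,i}\mathscr{Y}_{n,j}=\mathscr{Y}_{n,j}\mathscr{Y}_{n,i}$.
   Context: Let $q$ be an indeterminate. $H_n(q)$ is the unital associative $\mathbb{C}(q)$-algebra generated by $T_1,\dots,T_{n-1}$ with relations $T_i^2=(q-1)T_i+q$ for $1\le i\le n-1$, $T_iT_j=T_jT_i$ for $|i-j|\ge2$, and $T_iT_{i+1}T_i=T_{i+1}T_iT_{i+1}$ for $1\le i\le n-2$. Let $\mathfrak{S}_n$ be the symmetric group with simple transpositions $s_i=(i,i+1)$ and Coxeter length $\ell$. For $w\in\mathfrak{S}_n$ with reduced expression $w=s_{i_1}\cdots s_{i_k}$ put $T_w=T_{i_1}\cdots T_{i_k}$ (with $T_e=1$); this is independent of the reduced expression and $\{T_w : w\in\mathfrak{S}_n\}$ is a $\mathbb{C}(q)$-basis of $H_n(q)$. For $0\le k\le\binom n2$ put $\mathscr{Y}_{n,k}=\sum_{w\in\mathfrak{S}_n,\ \ell(w)=k}T_w$. *)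

(* Defs.v *)
From HB Require Import structures.
From mathcomp Require Import all_boot all_order all_fingroup all_algebra.
From mathcomp Require Import generic_quotient boolp reals complex monalg.

Set Implicit Arguments.
Unset Strict Implicit.
Unset Printing Implicit Defensive.

Import GRing.Theory.
Local Open Scope ring_scope.
Local Open Scope quotient_scope.

Section SimpleTranspositions.
Variable n : nat.

Fact ltn_gen (i : 'I_n.-1) : (i < n)%N.
Proof. by case: n i => [|m] [i lt_i] //=; apply: leq_trans lt_i _. Qed.

Fact ltn_genS (i : 'I_n.-1) : (i.+1 < n)%N.
Proof. by case: n i => [|m] [i lt_i]. Qed.

(* The index i < n.-1 stands for the i.+1-st generator, and points of
   {1, ..., n} are likewise shifted to {0, ..., n-1}. *)
Definition simple (i : 'I_n.-1) : 'S_n :=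
  tperm (Ordinal (ltn_gen i)) (Ordinal (ltn_genS i)).

Definition word_prod (s : seq 'I_n.-1) : 'S_n := (\prod_(i <- s) simple i)%g.

Lemma word_prod_surj (w : 'S_n) : exists s, w = word_prod s.
Proof.
have catP u v : (exists s, u = word_prod s) -> (exists s, v = word_prod s) ->
    exists s, (u * v)%g = word_prod s.
  by case=> s -> [t ->]; exists (s ++ t); rewrite /word_prod big_cat.
have simpleP i : exists s, simple i = word_prod s.
  by exists [:: i]; rewrite /word_prod big_seq1.
have ltP d : forall x y : 'I_n, y = (x + d)%N :> nat ->
    exists s, tperm x y = word_prod s.
  elim: d => [|d IHd] x y Dy.
    have ->: y = x by apply: val_inj; rewrite /= Dy addn0.
    by exists [::]; rewrite tperm1 /word_prod big_nil.
  have lt_z : (x + d < n.-1)%N.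
    have lt_y : ((x + d).+1 < n)%N by rewrite -addnS -Dy.
    by rewrite -ltnS (ltn_predK lt_y).
  have Ey : y = Ordinal (ltn_genS (Ordinal lt_z)).
    by apply: val_inj; rewrite /= Dy addnS.
  case: d IHd lt_z Ey Dy => [|d] IHd lt_z Ey Dy.
    have Ex : x = Ordinal (ltn_gen (Ordinal lt_z)).
      by apply: val_inj; rewrite /= addn0.
    by have [s Ds] := simpleP (Ordinal lt_z); exists s; rewrite -Ds {1}Ex Ey.
  set z := Ordinal (ltn_gen (Ordinal lt_z)).
  have ->: tperm x y =
      (simple (Ordinal lt_z) * (tperm x z * simple (Ordinal lt_z)))%g.
    rewrite -{1}[simple _]tpermV -/(conjg _ _) tpermJ.
    have lt_xz : (x < z)%N by rewrite /= addnS ltnS leq_addr.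
    have lt_xy : (x < y)%N by rewrite Dy addnS ltnS leq_addr.
    by rewrite tpermL -Ey tpermD // -val_eqE gtn_eqF.
  by do 2!apply: (catP) => //; apply: (IHd).
have tpermP x y : exists s, tperm x y = word_prod s.
  wlog le_xy : x y / (x <= y)%N.
    by move=> IH; case: (leqP x y) => [|/ltnW] /IH //; rewrite tpermC.
  by apply: (ltP (y - x)%N); rewrite subnKC.
have [ts -> _] := prod_tpermP w.
elim: ts => [|t ts IHts]; first by exists [::]; rewrite /word_prod !big_nil.
by rewrite big_cons; apply: catP.
Qed.

Definition has_word (w : 'S_n) (k : nat) : bool :=
  [exists s : k.-tuple 'I_n.-1, w == word_prod s].

Lemma has_word_ex (w : 'S_n) : exists k, has_word w k.
Proof.
have [s Ds] := word_prod_surj w; exists (size s).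
by apply/existsP; exists (in_tuple s); rewrite -Ds.
Qed.

(* Coxeter length: the least number of simple transpositions in a word for w. *)
Definition coxlen (w : 'S_n) : nat := ex_minn (has_word_ex w).

Lemma coxlen_has_word (w : 'S_n) : exists s : (coxlen w).-tuple 'I_n.-1,
  w == word_prod s.
Proof. by apply/existsP; rewrite -/(has_word _ _) /coxlen; case: ex_minnP. Qed.

(* An arbitrary reduced word of w. The product of 'S_n is read from left to
   right; the opposite convention would replace w by w^-1, of equal length. *)
Definition redword (w : 'S_n) : seq 'I_n.-1 := xchoose (coxlen_has_word w).

Lemma redwordP (w : 'S_n) :
  size (redword w) = coxlen w /\ w = word_prod (redword w).
Proof.
by split; [apply: size_tuple | apply/eqP/(xchooseP (coxlen_has_word w))].
Qed.

End SimpleTranspositions.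

Section TwoSidedIdeal.
Variables (K : comNzRingType) (A : algType K) (rel : A -> Prop).

Inductive ideal_gen : A -> Prop :=
| IdealGen x of rel x : ideal_gen x
| Ideal0 : ideal_gen 0
| IdealD x y of ideal_gen x & ideal_gen y : ideal_gen (x + y)
| IdealMl u x of ideal_gen x : ideal_gen (u * x)
| IdealMr x u of ideal_gen x : ideal_gen (x * u).

Lemma ideal_genN x : ideal_gen x -> ideal_gen (- x).
Proof. by rewrite -mulN1r; apply: IdealMl. Qed.

Lemma ideal_gen_proper (B : nzRingType) (f : {rmorphism A -> B}) :
  (forall x, rel x -> f x = 0) -> ~ ideal_gen 1.
Proof.
move=> f_rel I1; suff /eqP: f 1 = 0 by rewrite rmorph1 oner_eq0.
elim: I1 => {}// [|x y _ fx _ fy|u x _ fx|x u _ fx]; first exact: rmorph0.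
- by rewrite rmorphD fx fy addr0.
- by rewrite rmorphM fx mulr0.
- by rewrite rmorphM fx mul0r.
Qed.

Definition ideal_equiv (x y : A) : bool := `[< ideal_gen (x - y) >].

Lemma ideal_equiv_is_equiv : equiv_class_of ideal_equiv.
Proof.
split=> [x|x y|y x z].
- by apply/asboolP; rewrite subrr; apply: Ideal0.
- by apply/asboolP/asboolP => /ideal_genN; rewrite opprB.
- move=> /asboolP xy /asboolP yz; apply/asboolP.
  by rewrite -(subrKA y); apply: IdealD.
Qed.

Canonical ideal_equiv_equiv := EquivRelPack ideal_equiv_is_equiv.
Canonical ideal_equiv_encModRel := defaultEncModRel ideal_equiv.

(* Properness is an argument because 1 != 0 in an algType. *)
Definition alg_quot of ~ ideal_gen 1 : Type := {eq_quot ideal_equiv}.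

Variable proper : ~ ideal_gen 1.
Local Notation Q := (alg_quot proper).

HB.instance Definition _ := Choice.copy Q {eq_quot ideal_equiv}.
HB.instance Definition _ := EqQuotient.copy Q {eq_quot ideal_equiv}.

Lemma alg_quotP (x y : A) : \pi_Q x = \pi_Q y <-> ideal_gen (x - y).
Proof. by split=> [/eqquotP/asboolP|xy]; last exact/eqquotP/asboolP. Qed.

Lemma alg_quot_repr (x : A) : ideal_gen (repr (\pi_Q x) - x).
Proof. by apply/alg_quotP; rewrite reprK. Qed.

Definition quot_zero : Q := lift_cst Q 0.
Definition quot_one : Q := lift_cst Q 1.
Definition quot_opp := lift_op1 Q -%R.
Definition quot_add := lift_op2 Q +%R.
Definition quot_mul := lift_op2 Q *%R.
Definition quot_scale (a : K) := lift_op1 Q ( *:%R a).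

Canonical quot_zero_morph := PiConst quot_zero.
Canonical quot_one_morph := PiConst quot_one.

Lemma quot_piN : {morph \pi_Q : x / - x >-> quot_opp x}.
Proof.
move=> x; unlock quot_opp; apply/esym/alg_quotP; rewrite -opprD.
exact/ideal_genN/alg_quot_repr.
Qed.
Canonical quot_piN_morph := PiMorph1 quot_piN.

Lemma quot_piD : {morph \pi_Q : x y / x + y >-> quot_add x y}.
Proof.
move=> x y; unlock quot_add; apply/esym/alg_quotP; rewrite opprD addrACA.
by apply: IdealD; apply: alg_quot_repr.
Qed.
Canonical quot_piD_morph := PiMorph2 quot_piD.

Lemma quot_piM : {morph \pi_Q : x y / x * y >-> quot_mul x y}.
Proof.
move=> x y; unlock quot_mul; apply/esym/alg_quotP.
rewrite -(subrKA (repr (\pi_Q x) * y)) -mulrBr -mulrBl.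
apply: IdealD; first exact/IdealMl/alg_quot_repr.
exact/IdealMr/alg_quot_repr.
Qed.
Canonical quot_piM_morph := PiMorph2 quot_piM.

Lemma quot_piZ a : {morph \pi_Q : x / a *: x >-> quot_scale a x}.
Proof.
move=> x; unlock quot_scale; apply/esym/alg_quotP.
by rewrite -scalerBr -mulr_algl; apply/IdealMl/alg_quot_repr.
Qed.
Canonical quot_piZ_morph a := PiMorph1 (quot_piZ a).

Lemma quot_addA : associative quot_add.
Proof. by move=> x y z; rewrite -[x]reprK -[y]reprK -[z]reprK !piE addrA. Qed.

Lemma quot_addC : commutative quot_add.
Proof. by move=> x y; rewrite -[x]reprK -[y]reprK !piE addrC. Qed.

Lemma quot_add0 : left_id quot_zero quot_add.
Proof. by move=> x; rewrite -[x]reprK !piE add0r. Qed.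

Lemma quot_addN : left_inverse quot_zero quot_opp quot_add.
Proof. by move=> x; rewrite -[x]reprK !piE addNr. Qed.

HB.instance Definition _ :=
  GRing.isZmodule.Build Q quot_addA quot_addC quot_add0 quot_addN.

Lemma quot_mulA : associative quot_mul.
Proof. by move=> x y z; rewrite -[x]reprK -[y]reprK -[z]reprK !piE mulrA. Qed.

Lemma quot_mul1l : left_id quot_one quot_mul.
Proof. by move=> x; rewrite -[x]reprK !piE mul1r. Qed.

Lemma quot_mul1r : right_id quot_one quot_mul.
Proof. by move=> x; rewrite -[x]reprK !piE mulr1. Qed.

Lemma quot_mulDl : left_distributive quot_mul quot_add.
Proof. by move=> x y z; rewrite -[x]reprK -[y]reprK -[z]reprK !piE mulrDl. Qed.

Lemma quot_mulDr : right_distributive quot_mul quot_add.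
Proof. by move=> x y z; rewrite -[x]reprK -[y]reprK -[z]reprK !piE mulrDr. Qed.

Lemma quot_one_neq0 : quot_one != quot_zero.
Proof.
have -> : quot_one = \pi_Q 1 by rewrite piE.
have -> : quot_zero = \pi_Q 0 by rewrite piE.
by apply/eqP=> /alg_quotP; rewrite subr0.
Qed.

HB.instance Definition _ := GRing.Zmodule_isNzRing.Build Q
  quot_mulA quot_mul1l quot_mul1r quot_mulDl quot_mulDr quot_one_neq0.

Lemma quot_scaleA a b v : quot_scale a (quot_scale b v) = quot_scale (a * b) v.
Proof. by rewrite -[v]reprK !piE scalerA. Qed.

Lemma quot_scale1 : left_id 1 quot_scale.
Proof. by move=> x; rewrite -[x]reprK !piE scale1r. Qed.

Lemma quot_scaleDr : right_distributive quot_scale quot_add.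
Proof. by move=> a x y; rewrite -[x]reprK -[y]reprK !piE scalerDr. Qed.

Lemma quot_scaleDl v a b :
  quot_scale (a + b) v = quot_add (quot_scale a v) (quot_scale b v).
Proof. by rewrite -[v]reprK !piE scalerDl. Qed.

HB.instance Definition _ := GRing.Zmodule_isLmodule.Build K Q
  quot_scaleA quot_scale1 quot_scaleDr quot_scaleDl.

Lemma quot_scaleAl a u v :
  quot_scale a (quot_mul u v) = quot_mul (quot_scale a u) v.
Proof. by rewrite -[u]reprK -[v]reprK !piE scalerAl. Qed.

HB.instance Definition _ := GRing.Lmodule_isLalgebra.Build K Q quot_scaleAl.

Lemma quot_scaleAr a u v :
  quot_scale a (quot_mul u v) = quot_mul u (quot_scale a v).
Proof. by rewrite -[u]reprK -[v]reprK !piE scalerAr. Qed.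

HB.instance Definition _ := GRing.Lalgebra_isAlgebra.Build K Q quot_scaleAr.

End TwoSidedIdeal.

Section FreeAlgebra.
Variables (K : comNzRingType) (I : choiceType).

(* The alias is needed because the algType instance of monalg is reserved to
   commutative monoids and would shadow this one. *)
Definition freealg : Type := {malg K[{fmonom I}]}.
HB.instance Definition _ := GRing.Lalgebra.on freealg.

Definition freegen (i : I) : freealg := << fmu i >>.

Lemma malg_scaleAr (M : monomType) (a : K) (x y : {malg K[M]}) :
  a *: (x * y) = x * (a *: y).
Proof.
have comm_a : a%:MP * x = x * a%:MP.
  rewrite (monalgE x) mulr_sumr mulr_suml; apply: eq_bigr => k _.
  by rewrite !malgM_def !fgmulUU mul1m mulm1 mulrC.
by rewrite -!mul_malgC mulrA comm_a mulrA.
Qed.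

HB.instance Definition _ :=
  GRing.Lalgebra_isAlgebra.Build K freealg (@malg_scaleAr {fmonom I}).

End FreeAlgebra.

Section HeckeRelators.
Variables (K : comNzRingType) (q : K) (m : nat) (A : algType K) (t : 'I_m -> A).

Inductive hecke_relator : A -> Prop :=
| HeckeQuadratic i :
    hecke_relator (t i ^+ 2 - ((q - 1) *: t i + q%:A))
| HeckeCommute (i j : 'I_m) of (i.+2 <= j)%N || (j.+2 <= i)%N :
    hecke_relator (t i * t j - t j * t i)
| HeckeBraid (i j : 'I_m) of j = i.+1 :> nat :
    hecke_relator (t i * t j * t i - t j * t i * t j).

(* The relators vanish under the character sending every generator to q. *)
Lemma hecke_relator_trivial (f : {rmorphism A -> K}) (x : A) :
  scalable_for *%R f -> (forall i, f (t i) = q) -> hecke_relator x -> f x = 0.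
Proof.
move=> fZ ft [i|i j _|i j _].
- rewrite rmorphB rmorphXn rmorphD !fZ rmorph1 !ft.
  by rewrite mulr1 mulrBl mul1r subrK expr2 subrr.
- by rewrite rmorphB !rmorphM /= !ft subrr.
- by rewrite rmorphB !rmorphM /= !ft subrr.
Qed.

End HeckeRelators.

Section HeckeAlgebra.
Variables (K : comNzRingType) (q : K) (n : nat).

Definition trivial_weight (m : {fmonom 'I_n.-1}) : K := q ^+ size m.

Lemma trivial_weight_mmorphism : mmorphism trivial_weight.
Proof.
by split=> [x y|]; rewrite /trivial_weight ?fm1 // fmM size_cat exprD.
Qed.

HB.instance Definition _ :=
  isMultiplicative.Build _ _ trivial_weight trivial_weight_mmorphism.

Lemma hecke_proper : ~ ideal_gen (hecke_relator q (@freegen K 'I_n.-1)) 1.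
Proof.
pose f : {rmorphism freealg K 'I_n.-1 -> K} :=
  mmap idfun trivial_weight.
apply: (ideal_gen_proper (f := f)) => x.
apply: hecke_relator_trivial => [a y|i]; first exact: mmapZ.
by rewrite /f /= mmapU /trivial_weight fmU mul1r.
Qed.

Definition hecke : algType K := alg_quot hecke_proper.

Definition hecke_gen (i : 'I_n.-1) : hecke :=
  \pi_(alg_quot hecke_proper) (freegen K i).

Definition hecke_T (w : 'S_n) : hecke := \prod_(i <- redword w) hecke_gen i.

Definition hecke_Y (k : nat) : hecke :=
  \sum_(w : 'S_n | coxlen w == k) hecke_T w.

End HeckeAlgebra.

Definition Cq (R : realType) : fieldType := {fraction {poly R[i]}}.

Definition qvar (R : realType) : Cq R := FracField.tofrac 'X.

Definition Hn (R : realType) (n : nat) : algType (Cq R) := hecke (qvar R) n.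

Definition Ynk (R : realType) (n k : nat) : Hn R n := hecke_Y (qvar R) n k.

(* Z[q] as a subring of C(q): the value of an integer polynomial at q. *)
Definition Zq (R : realType) (c : {poly int}) : Cq R :=
  (map_poly intr c).[qvar R].

(* Main.v *)
(* The algebra H_n(q) has an anti-automorphism fixing every generator. By
   Matsumoto's theorem, T_w does not depend on the reduced word, so it sends
   T_w to T_(w^-1); as w and w^-1 have the same length, it fixes every Y_k.
   Applied to Y_i Y_j it gives Y_j Y_i, but if Y_i Y_j is a combination of
   the Y_k then it is fixed. *)
Require Import Defs.
From mathcomp Require Import all_boot all_order all_fingroup all_algebra.
From mathcomp Require Import zify.
From mathcomp Require Import generic_quotient boolp reals monalg.

Set Implicit Arguments.
Unset Strict Implicit.
Unset Printing Implicit Defensive.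

Import GRing.Theory.

(** * Coxeter length as the number of inversions *)

Section Inversions.
Variable n : nat.
Implicit Types (w : 'S_n) (s t : seq 'I_n.-1) (a b : 'I_n.-1).

Definition inversions w : {set 'I_n * 'I_n} :=
  [set p : 'I_n * 'I_n | (p.1 < p.2)%N && (w p.2 < w p.1)%N].

(** Products in ['S_n] apply the left factor first, so [simple a * w] exchanges the values of [w] at
    positions [a] and [a.+1]. This is the notion of descent suited to words that begin with [a]. *)
Definition descent w a : bool :=
  (w (Ordinal (ltn_genS a)) < w (Ordinal (ltn_gen a)))%N.

Lemma simpleK a : (simple a * simple a)%g = 1%g.
Proof. exact: tperm2. Qed.

Lemma mul_simpleK a w : (simple a * (simple a * w))%g = w.
Proof. by rewrite mulgA simpleK mul1g. Qed.

Lemma val_simple a (x : 'I_n) :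
  simple a x = (if x == a :> nat then a.+1 else
                if x == a.+1 :> nat then a : nat else x) :> nat.
Proof.
rewrite /simple permE /= -!val_eqE /=.
by case: eqP => // _; case: eqP.
Qed.

Lemma simpleC a b : (a.+2 <= b)%N ->
  (simple a * simple b)%g = (simple b * simple a)%g.
Proof.
move=> ab; apply/permP=> x; apply: val_inj; rewrite !permM /= !val_simple.
by repeat case: eqP => //; lia.
Qed.

Lemma simple_braid a b : b = a.+1 :> nat ->
  (simple a * simple b * simple a)%g = (simple b * simple a * simple b)%g.
Proof.
move=> ab; apply/permP=> x; apply: val_inj; rewrite !permM /= !val_simple ab.
by repeat case: eqP => //; lia.
Qed.

Lemma word_prod_cons a s : word_prod (a :: s) = (simple a * word_prod s)%g.
Proof. by rewrite /word_prod big_cons. Qed.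

Lemma word_prod_rev s : word_prod (rev s) = (word_prod s)^-1%g.
Proof.
elim: s => [|a s IHs]; first by rewrite /word_prod big_nil invg1.
rewrite rev_cons -cats1 /word_prod big_cat big_seq1 -!/(word_prod _) IHs.
by rewrite word_prod_cons invMg tpermV.
Qed.

Lemma descent_simple a w : descent (simple a * w)%g a = ~~ descent w a.
Proof.
rewrite /descent !permM tpermL tpermR.
by case: ltngtP => // /val_inj/perm_inj/(congr1 val) /= E; lia.
Qed.

(* Exchanging positions a and a+1 permutes the other pairs of positions. *)
Lemma inversions_simple a w : ~~ descent w a ->
  #|inversions (simple a * w)%g| = #|inversions w|.+1.
Proof.
set x := Ordinal (ltn_gen a); set y := Ordinal (ltn_genS a) => wa.
have Dxy: (x, y) \in inversions (simple a * w)%g.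
  by rewrite inE /= leqnn; move: wa; rewrite -descent_simple.
rewrite (cardsD1 (x, y)) Dxy add1n; congr _.+1.
pose f (p : 'I_n * 'I_n) := (simple a p.1, simple a p.2).
have fK: involutive f.
  by case=> u v; rewrite /f /= !tpermK.
have NDxy : (x, y) \notin inversions w by rewrite inE /= leqnn.
rewrite -(card_imset (mem (inversions w)) (inv_inj fK)).
apply: eq_card => p; rewrite -[p]fK mem_imset; last exact: inv_inj.
case: (f p) => u v {p}; rewrite !inE /f /= !permM !tpermK.
rewrite xpair_eqE -!val_eqE /=.
rewrite !val_simple.
move: wa; rewrite /descent -/x -/y => wa.
have [wuv|] := boolP (w v < w u)%N; last by rewrite !andbF.
rewrite !andbT.
(* The pair of positions [a], [a.+1] is the only one that could be lost, and it is not an inversion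
   of [w] because [a] is not a descent. *)
have : ~ (u = x /\ v = y).
  by case=> ux vy; move: wuv wa; rewrite ux vy => ->.
move=> xy.
have {xy}: ~ (u = a :> nat /\ v = a.+1 :> nat).
  by case=> ux vy; apply: xy; split; apply: val_inj.
by clear; repeat case: eqP; lia.
Qed.

Lemma inversions_descent a w : descent w a ->
  #|inversions w| = #|inversions (simple a * w)%g|.+1.
Proof.
move=> wa; rewrite -(inversions_simple (a := a)) ?mul_simpleK //.
by rewrite descent_simple negbK.
Qed.

(** Without descents [w] is increasing, so [x <= w x] for every [x]. Both sides have the same sum
    because [w] permutes the points, hence every inequality is an equality. *)
Lemma no_descent w : (forall a, ~~ descent w a) -> w = 1%g.
Proof.
move=> wN.
have le_w : forall k (x : 'I_n), x = k :> nat -> (x <= w x)%N.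
  elim=> [|k IHk] x xk; first by rewrite xk.
  have ltk : (k < n.-1)%N by have := ltn_ord x; lia.
  pose a := Ordinal ltk.
  have := wN a; rewrite /descent.
  have -> : Ordinal (ltn_genS a) = x by apply: val_inj; rewrite /= xk.
  have := IHk (Ordinal (ltn_gen a)) erefl => /= le1.
  rewrite -leqNgt leq_eqVlt.
  by case/orP=> [/eqP/val_inj/perm_inj/(congr1 val) /=|]; lia.
have wE : forall x : 'I_n, true -> (x <= w x ?= iff (val x == val (w x)))%N.
  by move=> x _; split; rewrite ?(le_w x x) //.
have [_] := leqif_sum wE.
rewrite [X in X == _](reindex_inj (@perm_inj _ w)) eqxx.
move=> /esym/forallP wid; apply/permP=> x; rewrite perm1.
by apply: val_inj; apply/esym/eqP; have := wid x.
Qed.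

Lemma inversions1 : #|inversions 1%g| = 0.
Proof.
by apply: eq_card0 => -[x y]; rewrite !inE !perm1 /=; case: ltngtP.
Qed.

Lemma inversions_word_prod s : (#|inversions (word_prod s)| <= size s)%N.
Proof.
elim: s => [|a s IHs]; first by rewrite /word_prod big_nil inversions1.
rewrite word_prod_cons /=; case: (boolP (descent (word_prod s) a)) => wa.
  by apply: leqW; apply: leq_trans IHs; rewrite (inversions_descent wa).
by rewrite (inversions_simple wa).
Qed.

(** Bubble sort: as long as a descent exists, multiplying by it on the left removes one inversion,
    and the letters used spell the word. *)
Lemma inversions_has_word w :
  exists2 s, w = word_prod s & size s = #|inversions w|.
Proof.
move: {2}#|inversions w| (erefl #|inversions w|) => k.
elim: k w => [|k IHk] w wk.
  exists [::]; rewrite ?wk // /word_prod big_nil; apply: no_descent => a.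
  by apply/negP=> /inversions_descent; rewrite wk.
case: (pickP (descent w)) => [a wa | w0]; last first.
  by move: wk; rewrite (no_descent (w := w)) ?inversions1 // => a; rewrite w0.
have [|s Es ss] := IHk (simple a * w)%g.
  by apply/eq_add_S; rewrite -wk (inversions_descent wa).
exists (a :: s); first by rewrite word_prod_cons -Es mul_simpleK.
by rewrite /= ss (inversions_descent wa).
Qed.

Lemma coxlenE w : coxlen w = #|inversions w|.
Proof.
rewrite /coxlen; case: ex_minnP => k /existsP[s /eqP ->] kmin.
have [t Et st] := inversions_has_word (word_prod s).
apply/eqP; rewrite eqn_leq kmin.
  by rewrite -[X in (_ <= X)%N](size_tuple s) inversions_word_prod.
by rewrite -st; apply/existsP; exists (in_tuple t); rewrite -Et.
Qed.

Lemma coxlen_descent a w :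
  descent w a -> coxlen w = (coxlen (simple a * w)%g).+1.
Proof. by rewrite !coxlenE; apply: inversions_descent. Qed.

Lemma coxlen_simple a w :
  ~~ descent w a -> coxlen (simple a * w)%g = (coxlen w).+1.
Proof. by rewrite !coxlenE; apply: inversions_simple. Qed.

Lemma coxlen_word_prod s : (coxlen (word_prod s) <= size s)%N.
Proof. by rewrite coxlenE inversions_word_prod. Qed.

(** Reversing a reduced word of [u] gives a word of the same size for its inverse; this bound is
    used for both [w] and [w^-1]. *)
Lemma coxlenV w : coxlen w^-1%g = coxlen w.
Proof.
suff le_V (u : 'S_n) : (coxlen u^-1%g <= coxlen u)%N.
  by apply/eqP; rewrite eqn_leq le_V -{1}[w]invgK le_V.
have [su Du] := redwordP u; rewrite -su {1}Du.
by rewrite -word_prod_rev -size_rev coxlen_word_prod.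
Qed.

(** If [a] were not a descent, cancelling it would raise the length to [(size s).+2], which is more
    than the word [s] allows. *)
Lemma coxlen_descent_cons a s : coxlen (word_prod (a :: s)) = (size s).+1 ->
  descent (word_prod (a :: s)) a /\ coxlen (word_prod s) = size s.
Proof.
rewrite word_prod_cons => red; have le_s := coxlen_word_prod s.
case: (boolP (descent (simple a * word_prod s)%g a)) => [d|].
  by split=> //; move: red; rewrite (coxlen_descent d) mul_simpleK; lia.
by move/coxlen_simple; rewrite red mul_simpleK; lia.
Qed.

(** * Products over reduced words of the same permutation *)

Section Matsumoto.
Local Open Scope ring_scope.
Variables (A : pzRingType) (f : 'I_n.-1 -> A).
Hypothesis f_comm : forall a b, (a.+2 <= b)%N -> f a * f b = f b * f a.
Hypothesis f_braid :
  forall a b, b = a.+1 :> nat -> f a * f b * f a = f b * f a * f b.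

(* Matsumoto's theorem: when a and b are both descents of w, a reduced word
   of w may be chosen to start with the longest element of <s_a, s_b>. *)
Lemma reduced_word_prod_eq s t : word_prod s = word_prod t ->
    coxlen (word_prod s) = size s -> coxlen (word_prod t) = size t ->
  \prod_(a <- s) f a = \prod_(a <- t) f a.
Proof.
move: {2}(size s) (erefl (size s)) => k; elim: k s t => [|k IHk] s t.
  by move/size0nil=> -> <- -> /esym/size0nil->.
have wlog_lt : forall a b s t, (a < b)%N -> size (a :: s) = k.+1 ->
    word_prod (a :: s) = word_prod (b :: t) ->
    coxlen (word_prod (a :: s)) = size (a :: s) ->
    coxlen (word_prod (b :: t)) = size (b :: t) ->
  \prod_(c <- a :: s) f c = \prod_(c <- b :: t) f c.
  move=> a b {}s {}t lt_ab /= [sk] Est reds redt.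
  have tk : size t = k by move: redt; rewrite -Est reds; lia.
  have [da rs] := coxlen_descent_cons reds.
  have [db rt] := coxlen_descent_cons redt.
  set w := word_prod (a :: s) in Est reds da; rewrite -Est in redt db.
  have Es : word_prod s = (simple a * w)%g.
    by rewrite /w word_prod_cons mul_simpleK.
  have Et : word_prod t = (simple b * w)%g.
    by rewrite Est word_prod_cons mul_simpleK.
  move: lt_ab; rewrite leq_eqVlt => /orP[/eqP Eb | lt_ab]; last first.
    (* Commuting case: [simple a] fixes the positions [b] and [b.+1], so [b] remains a descent once
       [a] is removed. The tails [s] and [t] are then compared by induction with [b :: u] and
       [a :: u]. *)
    have dba : descent (simple a * w)%g b.
      move: db; rewrite /descent !permM; congr (w _ < w _)%N;
        apply: val_inj; rewrite /= val_simple /=; do 2?case: eqP; lia.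
    have [ru Eu] := redwordP (simple b * (simple a * w))%g.
    set u := redword _ in ru Eu.
    have lu : (size u).+1 = k by rewrite ru -(coxlen_descent dba) -Es rs.
    have E1 : word_prod s = word_prod (b :: u).
      by rewrite Es word_prod_cons -Eu mul_simpleK.
    have E2 : word_prod t = word_prod (a :: u).
      rewrite Et word_prod_cons -Eu (mulgA (simple b)) -simpleC //.
      by rewrite -mulgA mul_simpleK.
    rewrite 2!big_cons (IHk s (b :: u)) ?(IHk t (a :: u)) -?E1 -?E2 ?rs ?rt //=;
      rewrite ?sk ?tk ?lu //.
    by rewrite !big_cons !mulrA f_comm.
  (* Braid case [b = a.+1]: the values of [w] decrease along the positions [a], [a.+1], [a.+2], so
     removing [a], then [b], then [a] meets a descent each time. The tails are compared with
     [[:: b, a & u]] and [[:: a, b & u]]. *)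
  have Eba : Ordinal (ltn_gen b) = Ordinal (ltn_genS a).
    by apply: val_inj; rewrite /= -Eb.
  have dba : descent (simple a * w)%g b.
    move: da db; rewrite /descent !permM Eba tpermR.
    by rewrite tpermD -?val_eqE /= -?Eb; lia.
  have daba : descent (simple b * (simple a * w))%g a.
    move: da db; rewrite /descent !permM -Eba tpermL.
    rewrite (@tpermD _ (Ordinal (ltn_gen b)) _ (Ordinal (ltn_gen a)));
      rewrite -?val_eqE /= -?Eb; try lia.
    rewrite tpermL tpermD -?val_eqE /= -?Eb; try lia.
    by rewrite Eba.
  have [ru Eu] := redwordP (simple a * (simple b * (simple a * w)))%g.
  set u := redword _ in ru Eu.
  have lu : (size u).+2 = k.
    by rewrite ru -(coxlen_descent daba) -(coxlen_descent dba) -Es rs.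
  have E1 : word_prod s = word_prod [:: b, a & u].
    by rewrite Es !word_prod_cons -Eu !mul_simpleK.
  have E2 : word_prod t = word_prod [:: a, b & u].
    rewrite Et !word_prod_cons -Eu; have := simple_braid (esym Eb).
    by rewrite !mulgA => ->; rewrite -!mulgA !mul_simpleK.
  rewrite 2!big_cons (IHk s [:: b, a & u])
    ?(IHk t [:: a, b & u]) -?E1 -?E2 ?rs ?rt //=;
    rewrite ?sk ?tk ?lu //.
  by rewrite !big_cons !mulrA f_braid.
case: s t => [//|a s] [|b t] sk Est reds redt.
  by move: sk; rewrite -reds Est redt.
case: (ltngtP a b) => [lt_ab|lt_ba|/val_inj Eab]; first exact: wlog_lt.
  by apply/esym; apply: wlog_lt => //; rewrite -sk -reds Est redt.
rewrite !big_cons -Eab; congr (_ * _); apply: IHk.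
- by case: sk.
- by move: Est; rewrite -Eab !word_prod_cons => /mulgI.
- by have [] := coxlen_descent_cons reds.
- by have [] := coxlen_descent_cons redt.
Qed.

End Matsumoto.

End Inversions.

Local Open Scope ring_scope.

(** * Evaluation of the free algebra with words read backwards *)

Section ReverseEvaluation.
Variables (K : comNzRingType) (I : choiceType) (A : algType K) (g : I -> A).

(** This is the algebra morphism to the opposite of [A] determined by [g], written with values in
    [A] itself. *)
Definition rev_eval (x : freealg K I) : A :=
  mmap (in_alg A) (fun m : {fmonom I} => \prod_(i <- rev m) g i) x.

Lemma rev_evalD x y : rev_eval (x + y) = rev_eval x + rev_eval y.
Proof. exact: mmapD. Qed.

Lemma rev_evalB x y : rev_eval (x - y) = rev_eval x - rev_eval y.
Proof. exact: mmapB. Qed.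

Lemma rev_eval_sum (J : Type) (r : seq J) (F : J -> freealg K I) :
  rev_eval (\sum_(j <- r) F j) = \sum_(j <- r) rev_eval (F j).
Proof.
elim: r => [|j r IHr]; first by rewrite !big_nil; apply: mmap0.
by rewrite !big_cons rev_evalD IHr.
Qed.

Lemma rev_evalU c (m : {fmonom I}) :
  rev_eval << c *g m >> = c *: \prod_(i <- rev m) g i.
Proof. by rewrite /rev_eval mmapU /= mulr_algl. Qed.

(** By bilinearity it is enough to treat single words, where [rev] swaps the two parts of a
    concatenation. *)
Lemma rev_evalM x y : rev_eval (x * y) = rev_eval y * rev_eval x.
Proof.
rewrite (monalgE x) (monalgE y) mulr_suml !rev_eval_sum mulr_sumr.
apply: eq_bigr => k _; rewrite mulr_sumr rev_eval_sum mulr_suml.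
apply: eq_bigr => l _; rewrite malgM_def fgmulUU !rev_evalU fmM rev_cat big_cat.
by rewrite -scalerAl -scalerAr scalerA mulrC.
Qed.

Lemma rev_evalZ c (x : (freealg K I : algType K)) :
  rev_eval (c *: x) = c *: rev_eval x.
Proof.
(* Scaling is rewritten as multiplication by a constant, which lies on the empty word and so is sent
   to [c%:A]. *)
have -> : c *: x = c%:MP * x :> freealg K I by rewrite mul_malgC.
by rewrite [LHS]rev_evalM rev_evalU fm1 big_nil -scalerAr mulr1.
Qed.

Lemma rev_eval_gen i : rev_eval (freegen K i) = g i.
Proof. by rewrite rev_evalU scale1r fmU /= big_seq1. Qed.

Lemma rev_eval1 : rev_eval 1 = 1.
Proof. by rewrite rev_evalU scale1r fm1 /= big_nil. Qed.

End ReverseEvaluation.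

(** The Hecke relations are symmetric under reversal: the quadratic and braid relators keep their
    shape, and the commutation relator has [i] and [j] exchanged. *)
Lemma hecke_relator_anti (K : comNzRingType) (q : K) (m : nat)
    (F A : algType K) (t : 'I_m -> F) (u : 'I_m -> A) (phi : F -> A) :
  {morph phi : x y / x + y} -> {morph phi : x y / x - y} -> scalable phi ->
  {morph phi : x y / x * y >-> y * x} -> phi 1 = 1 ->
  (forall i, phi (t i) = u i) ->
  forall x, hecke_relator q t x -> hecke_relator q u (phi x).
Proof.
move=> phiD phiB phiZ phiM phi1 phi_t x [i|i j ij|i j ij].
- by rewrite expr2 phiB phiD !phiZ phiM phi1 phi_t; apply: HeckeQuadratic.
- by rewrite phiB !phiM !phi_t; apply: HeckeCommute; rewrite orbC.
- by rewrite phiB !phiM !phi_t !mulrA; apply: HeckeBraid.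
Qed.

(** * The anti-automorphism of the Hecke algebra *)

Section AntiInvolution.
Variables (K : comNzRingType) (q : K) (n : nat).
Local Notation H := (hecke q n).
Local Notation T := (@hecke_gen K q n).
Local Notation rel := (hecke_relator q (@freegen K 'I_n.-1)).
Local Notation pi := (\pi_(alg_quot (@hecke_proper K q n))%qT).

Lemma hecke_piD x y : pi (x + y) = pi x + pi y :> H.
Proof. exact: quot_piD. Qed.

Lemma hecke_piM x y : pi (x * y) = pi x * pi y :> H.
Proof. exact: quot_piM. Qed.

Lemma hecke_piZ a x : pi (a *: x) = a *: pi x :> H.
Proof. exact: quot_piZ. Qed.

Lemma hecke_pi1 : pi 1 = 1 :> H.
Proof. by rewrite piE. Qed.

Lemma hecke_pi_eq x y : rel (x - y) -> pi x = pi y :> H.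
Proof. by move=> xy; apply/alg_quotP; apply: IdealGen. Qed.

Lemma hecke_gen_comm (i j : 'I_n.-1) : (i.+2 <= j)%N || (j.+2 <= i)%N ->
  T i * T j = T j * T i.
Proof. by move=> ij; rewrite -!hecke_piM; apply/hecke_pi_eq/HeckeCommute. Qed.

Lemma hecke_gen_braid (i j : 'I_n.-1) : j = i.+1 :> nat ->
  T i * T j * T i = T j * T i * T j.
Proof. by move=> ij; rewrite -!hecke_piM; apply/hecke_pi_eq/HeckeBraid. Qed.

Lemma hecke_gen_quad i : T i ^+ 2 = (q - 1) *: T i + q%:A.
Proof.
rewrite expr2 -hecke_pi1 -!hecke_piZ -hecke_piM -hecke_piD.
by apply/hecke_pi_eq/HeckeQuadratic.
Qed.

Lemma hecke_relator0 x : hecke_relator q T x -> x = 0.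
Proof.
case=> [i|i j ij|i j ij].
- by rewrite hecke_gen_quad subrr.
- by rewrite hecke_gen_comm // subrr.
- by rewrite hecke_gen_braid // subrr.
Qed.

(** This makes [rev_eval] descend to the quotient. Left and right multiples change sides, which a
    two-sided ideal tolerates. *)
Lemma rev_eval_ideal x : ideal_gen rel x -> rev_eval T x = 0.
Proof.
elim=> {x} [x rx||x y _ fx _ fy|u x _ fx|x u _ fx].
- apply: hecke_relator0; apply: (hecke_relator_anti _ _ _ _ _ _ rx).
  + exact: rev_evalD.
  + exact: rev_evalB.
  + exact: rev_evalZ.
  + exact: rev_evalM.
  + exact: rev_eval1.
  + exact: rev_eval_gen.
- exact: mmap0.
- by rewrite rev_evalD fx fy addr0.
- by rewrite rev_evalM fx mul0r.
- by rewrite rev_evalM fx mulr0.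
Qed.

(** The value is computed on a chosen representative; [hecke_anti_pi] shows that any other gives the
    same. *)
Definition hecke_anti (x : H) : H := rev_eval T (repr x).

Lemma hecke_anti_pi x : hecke_anti (pi x) = rev_eval T x.
Proof.
apply/eqP; rewrite -subr_eq0 -rev_evalB; apply/eqP/rev_eval_ideal.
exact: alg_quot_repr.
Qed.

Lemma hecke_antiD x y : hecke_anti (x + y) = hecke_anti x + hecke_anti y.
Proof.
by rewrite -[x]reprK -[y]reprK -hecke_piD !hecke_anti_pi rev_evalD.
Qed.

Lemma hecke_antiM x y : hecke_anti (x * y) = hecke_anti y * hecke_anti x.
Proof.
by rewrite -[x]reprK -[y]reprK -hecke_piM !hecke_anti_pi rev_evalM.
Qed.

Lemma hecke_antiZ a x : hecke_anti (a *: x) = a *: hecke_anti x.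
Proof. by rewrite -[x]reprK -hecke_piZ !hecke_anti_pi rev_evalZ. Qed.

Lemma hecke_anti_gen i : hecke_anti (T i) = T i.
Proof. by rewrite hecke_anti_pi rev_eval_gen. Qed.

Lemma hecke_anti1 : hecke_anti 1 = 1.
Proof. by rewrite -{1}hecke_pi1 hecke_anti_pi rev_eval1. Qed.

Lemma hecke_anti_sum (J : Type) (r : seq J) (P : pred J) (F : J -> H) :
  hecke_anti (\sum_(j <- r | P j) F j) = \sum_(j <- r | P j) hecke_anti (F j).
Proof.
have anti0 : hecke_anti 0 = 0.
  by rewrite -{1}(scale0r (0 : H)) hecke_antiZ scale0r.
elim/big_rec2: _ => [|k _ y _ <-]; first exact: anti0.
exact: hecke_antiD.
Qed.

Lemma hecke_anti_prod (s : seq 'I_n.-1) :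
  hecke_anti (\prod_(i <- s) T i) = \prod_(i <- rev s) T i.
Proof.
elim: s => [|i s IHs]; first by rewrite !big_nil hecke_anti1.
rewrite big_cons hecke_antiM IHs hecke_anti_gen rev_cons -cats1 big_cat.
by rewrite big_seq1.
Qed.

(** The reverse of [redword w] is a reduced word of [w^-1], but possibly not the one chosen by
    [redword]; [reduced_word_prod_eq] bridges the two. *)
Lemma hecke_anti_T (w : 'S_n) : hecke_anti (hecke_T q w) = hecke_T q w^-1%g.
Proof.
have [sw Dw] := redwordP w; have [sV DV] := redwordP w^-1%g.
rewrite hecke_anti_prod; apply: reduced_word_prod_eq.
- by move=> i j ij; apply: hecke_gen_comm; rewrite ij.
- exact: hecke_gen_braid.
- by rewrite word_prod_rev -Dw.
- by rewrite word_prod_rev -Dw size_rev sw coxlenV.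
- by rewrite -DV sV.
Qed.

Lemma hecke_anti_Y k : hecke_anti (hecke_Y q n k) = hecke_Y q n k.
Proof.
rewrite hecke_anti_sum [RHS](reindex_inj (@invg_inj _)) /=.
by apply: eq_big => w; rewrite ?coxlenV // hecke_anti_T.
Qed.

End AntiInvolution.

Theorem theorem1p4 (R : realType) (n i j : nat) :
  (2 <= n)%N ->
  (1 <= i <= 'C(n, 2))%N -> (1 <= j <= 'C(n, 2))%N -> i <> j ->
  (exists a b : nat,
     [/\ (`|i%:Z - j%:Z| <= a%:Z)%R, (a <= b)%N, (b <= minn (i + j) 'C(n, 2))%N
       & exists c : nat -> {poly int},
           (Ynk R n i * Ynk R n j =
            \sum_(a <= k < b.+1) Zq R (c k) *: Ynk R n k)%R]) ->
  (Ynk R n i * Ynk R n j = Ynk R n j * Ynk R n i)%R.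
Proof.
move=> _ _ _ _ [a [b [_ _ _ [c Yij]]]].
have : hecke_anti (Ynk R n i * Ynk R n j) = Ynk R n i * Ynk R n j.
  rewrite Yij hecke_anti_sum; apply: eq_bigr => k _.
  by rewrite hecke_antiZ hecke_anti_Y.
by rewrite hecke_antiM !hecke_anti_Y.
Qed.
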